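(* Let $n\ge 1$ and let $\vec{c}=(c_1,\ldots,c_n)\in\{-1,1\}^n$ with $c_1=1$. Then $Sym_{\vec{c}}$ and $AntiSym_{\vec{c}}$ (with matrix addition) are vector subspaces of the real vector space $M_{n,n}(\mathbb{R})$. For $A=(a_{ij})\in M_{n,n}(\mathbb{R})$, define matrices $A_S(\vec{c})$ and $A_{AS}(\vec{c})$ by $$(A_S(\vec{c}))_{ij}=\begin{cases}a_{ij},&\text{if } c_ic_j=1\\ 0,&\text{if } c_ic_j=-1\end{cases}\qquad (A_{AS}(\vec{c}))_{ij}=\begin{cases}0,&\text{if } c_ic_j=1\\ a_{ij},&\text{if } c_ic_j=-1.\end{cases}$$ Then $A_S(\vec{c})\in Sym_{\vec{c}}$, $A_{AS}(\vec{c})\in AntiSym_{\vec{c}}$, and $A=A_S(\vec{c})+A_{AS}(\vec{c})$. Moreover, $$Sym_{\vec{c}}\oplus AntiSym_{\vec{c}}=M_{n,n}(\mathbb{R}),$$ where $\oplus$ denotes the (internal) direct sum of subspaces.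
   Context: $M_{n,n}(\mathbb{R})$ is the set of real $n\times n$ matrices. For $\vec{c}=(c_1,\ldots,c_n)\in\{-1,1\}^n$ with $c_1=1$, the map $\varphi_{\vec{c}}:M_{n,n}(\mathbb{R})\to M_{n,n}(\mathbb{R})$ is defined by $(\varphi_{\vec{c}}(A))_{ij}=c_i\,a_{ij}\,c_j$ for $A=(a_{ij})$. A matrix $A$ is symmetric under $\varphi_{\vec{c}}$ if $\varphi_{\vec{c}}(A)=A$, and antisymmetric under $\varphi_{\vec{c}}$ if $\varphi_{\vec{c}}(A)=-A$. $Sym_{\vec{c}}$ (resp. $AntiSym_{\vec{c}}$) denotes the set of all matrices in $M_{n,n}(\mathbb{R})$ that are symmetric (resp. antisymmetric) under $\varphi_{\vec{c}}$. *)

(* Defs.v *)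
From HB Require Import structures.
From mathcomp Require Import all_boot all_order all_algebra.
From mathcomp Require Import reals.

Set Implicit Arguments.
Unset Strict Implicit.
Unset Printing Implicit Defensive.

Import GRing.Theory.
Local Open Scope ring_scope.

Definition is_sign_vec (R : realType) (n : nat) (c : 'rV[R]_n) : Prop :=
  forall i : 'I_n, c 0 i = -1 \/ c 0 i = 1.

Definition phi (R : realType) (n : nat) (c : 'rV[R]_n) (A : 'M[R]_n) : 'M[R]_n :=
  \matrix_(i, j) (c 0 i * A i j * c 0 j).

Definition Sym (R : realType) (n : nat) (c : 'rV[R]_n) : {pred 'M[R]_n} :=
  [pred A : 'M[R]_n | phi c A == A].

Definition AntiSym (R : realType) (n : nat) (c : 'rV[R]_n) : {pred 'M[R]_n} :=
  [pred A : 'M[R]_n | phi c A == - A].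

(* When c is a sign vector, c_i c_j is either 1 or -1, so in the next two
   definitions the else branch is exactly the case c_i c_j = -1. *)
Definition sym_part (R : realType) (n : nat) (c : 'rV[R]_n) (A : 'M[R]_n) :
    'M[R]_n :=
  \matrix_(i, j) (if c 0 i * c 0 j == 1 then A i j else 0).

Definition antisym_part (R : realType) (n : nat) (c : 'rV[R]_n) (A : 'M[R]_n) :
    'M[R]_n :=
  \matrix_(i, j) (if c 0 i * c 0 j == 1 then 0 else A i j).

(* Main.v *)
(* Sym_c and AntiSym_c are the eigenspaces of the linear map phi_c for 1 and -1,
   so they meet trivially in characteristic 0; they span because phi_c multiplies
   each entry a_ij by c_i c_j = 1 or -1. *)
Require Import Defs.
From HB Require Import structures.
From mathcomp Require Import all_boot all_order all_algebra.
From mathcomp Require Import reals.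

Set Implicit Arguments.
Unset Strict Implicit.
Unset Printing Implicit Defensive.

Import GRing.Theory.
Local Open Scope ring_scope.

Lemma phi_is_linear (R : realType) (n : nat) (c : 'rV[R]_n) : linear (phi c).
Proof.
move=> a A B; apply/matrixP => i j.
by rewrite !mxE mulrDr mulrDl mulrCA -!mulrA.
Qed.

(** With this structure [lfunE] identifies [linfun (phi c)] with [phi c], so kernels become
    available. *)
HB.instance Definition _ (R : realType) (n : nat) (c : 'rV[R]_n) :=
  GRing.isLinear.Build R 'M[R]_n 'M[R]_n *:%R (phi c) (phi_is_linear c).

(** Gathers both signs into the one factor that [sym_part] and [antisym_part] test. *)
Lemma phiE (R : realType) (n : nat) (c : 'rV[R]_n) (A : 'M[R]_n) i j :
  phi c A i j = c 0 i * c 0 j * A i j.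
Proof. by rewrite mxE mulrAC. Qed.

Lemma sign_vecM (R : realType) (n : nat) (c : 'rV[R]_n) i j :
  is_sign_vec c -> c 0 i * c 0 j != 1 -> c 0 i * c 0 j = -1.
Proof.
move=> hc; case: (hc i) => ->; case: (hc j) => ->;
  by rewrite ?mulrNN ?mulNr ?mulrN ?mulr1 ?mul1r ?eqxx.
Qed.

Lemma sym_part_Sym (R : realType) (n : nat) (c : 'rV[R]_n) (A : 'M[R]_n) :
  sym_part c A \in Sym c.
Proof.
rewrite inE; apply/eqP/matrixP => i j; rewrite phiE !mxE.
by case: eqP => [->|_]; rewrite ?mul1r ?mulr0.
Qed.

(** Retained entries have factor -1 by [sign_vecM]; the erased ones are 0, which is its own
    opposite. *)
Lemma antisym_part_AntiSym (R : realType) (n : nat) (c : 'rV[R]_n)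
    (A : 'M[R]_n) :
  is_sign_vec c -> antisym_part c A \in AntiSym c.
Proof.
move=> hc; rewrite inE; apply/eqP/matrixP => i j; rewrite phiE !mxE.
by case: ifPn => [_|/(sign_vecM hc) ->]; rewrite ?mulN1r ?mulr0 ?oppr0.
Qed.

Lemma sym_antisym_partD (R : realType) (n : nat) (c : 'rV[R]_n)
    (A : 'M[R]_n) :
  A = sym_part c A + antisym_part c A.
Proof.
by apply/matrixP => i j; rewrite !mxE; case: ifP; rewrite ?addr0 ?add0r.
Qed.

(** Realizes an eigenspace as a [{vspace vT}], so that both closure and directness come from vector
    space theory. *)
Lemma memv_lker_subZ (F : fieldType) (vT : vectType F) (f : 'End(vT)) a v :
  (v \in lker (f - a *: \1%VF)) = (f v == a *: v).
Proof. by rewrite memv_ker !lfun_simp subr_eq0. Qed.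

Lemma vspace_submod_closed (F : fieldType) (vT : vectType F) (U : {vspace vT})
    (S : {pred vT}) :
  U =i S -> submod_closed S.
Proof.
move=> US; split=> [|a u v]; rewrite -!US ?mem0v // => Uu Uv.
by rewrite memvD ?memvZ.
Qed.

Theorem theorem7 (R : realType) (n : nat) (hn : (0 < n)%N) (c : 'rV[R]_n)
    (hc : is_sign_vec c) (hc1 : c 0 (Ordinal hn) = 1) :
  [/\ submod_closed (Sym c),
      submod_closed (AntiSym c),
      forall A : 'M[R]_n,
        [/\ sym_part c A \in Sym c,
            antisym_part c A \in AntiSym c
          & A = sym_part c A + antisym_part c A]
    & exists U V : {vspace 'M[R]_n},
        [/\ U =i Sym c,
            V =i AntiSym c,
            directv (U + V)
          & (U + V)%VS = fullv]].
Proof.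
pose E a := lker (linfun (phi c) - a *: \1%VF).
have US : E 1 =i Sym c by move=> A; rewrite memv_lker_subZ lfunE scale1r.
have VA : E (-1) =i AntiSym c.
  by move=> A; rewrite memv_lker_subZ lfunE scaleN1r.
split; [exact: vspace_submod_closed US | exact: vspace_submod_closed VA | |].
  move=> A; split; [exact: sym_part_Sym | exact: antisym_part_AntiSym |].
  exact: sym_antisym_partD.
exists (E 1), (E (-1)).
split=> //.
  (* A common element satisfies [A = phi c A = - A]. *)
  apply/directv_addP/eqP; rewrite -subv0; apply/subvP => A.
  rewrite memv_cap US VA !inE memv0 => /andP[/eqP-> /eqP AN].
  apply/eqP/matrixP => i j; apply/eqP; move/matrixP/(_ i j): AN => /eqP.
  (* Each entry has a zero double, hence vanishes over the reals. *)
  by rewrite !mxE -addr_eq0 -mulr2n Num.Theory.mulrn_eq0.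
(* Spanning: the two parts of [A] are the required summands. *)
apply/vspaceP => A; rewrite memvf (sym_antisym_partD c A).
by rewrite memv_add ?US ?VA ?sym_part_Sym ?antisym_part_AntiSym.
Qed.
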